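(* Let $R$ be a ring with unity and let $G$ be a finite group of order $n$, where $n$ is invertible in $R$. Let $\sigma,\tau$ be arbitrary unital $R$-algebra endomorphisms of $RG$. Then every $(\sigma,\tau)$-derivation of $RG$ is inner.
   Context: $RG$ is the group ring. A unital $R$-algebra endomorphism of $RG$ is an $R$-linear ring endomorphism mapping $1$ to $1$ (it need not map $G$ into $G$). $R$ is not assumed commutative; $R$-linear means linear for the left $R$-module structure of $RG$. A $(\sigma,\tau)$-derivation of $RG$ is an $R$-linear map $D: RG\to RG$ with $D(\alpha\beta)=D(\alpha)\tau(\beta)+\sigma(\alpha)D(\beta)$ for all $\alpha,\beta\in RG$. It is inner if there exists $\beta\in RG$ such that $D(\alpha)=\beta\tau(\alpha)-\sigma(\alpha)\beta$ for all $\alpha\in RG$. *)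

(* Defs.v *)
From HB Require Import structures.
From mathcomp Require Import all_boot all_fingroup all_algebra.

Set Implicit Arguments.
Unset Strict Implicit.
Unset Printing Implicit Defensive.

Import GRing.Theory.

Local Open Scope ring_scope.

(* A wrapper, not an alias: {ffun G -> R} already carries a ring structure,
   with the pointwise product, whereas the product of RG is the convolution. *)
Record groupring (R : pzRingType) (G : finGroupType) : Type :=
  GroupRing { gcoef : {ffun G -> R} }.

HB.instance Definition _ (R : pzRingType) (G : finGroupType) :=
  [isNew for @gcoef R G].
HB.instance Definition _ (R : pzRingType) (G : finGroupType) :=
  [Choice of groupring R G by <:].

Section GroupRingStructure.

Variables (R : pzRingType) (G : finGroupType).
Implicit Types (a b c : groupring R G) (r s : R).

Definition gr_zero : groupring R G := GroupRing 0.
Definition gr_opp a : groupring R G := GroupRing (- gcoef a).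
Definition gr_add a b : groupring R G := GroupRing (gcoef a + gcoef b).

Definition gr_one : groupring R G := GroupRing [ffun g => (g == 1%g)%:R].
Definition gr_mul a b : groupring R G :=
  GroupRing [ffun g => \sum_(h : G) gcoef a h * gcoef b (h^-1 * g)%g].

Definition gr_scale r a : groupring R G :=
  GroupRing [ffun g => r * gcoef a g].

Lemma gr_eqP a b : (forall g, gcoef a g = gcoef b g) -> a = b.
Proof. by case: a b => [f] [f'] /= e; congr GroupRing; apply/ffunP. Qed.

Fact gr_addA : associative gr_add.
Proof. by move=> a b c; congr GroupRing; apply: addrA. Qed.
Fact gr_addC : commutative gr_add.
Proof. by move=> a b; congr GroupRing; apply: addrC. Qed.
Fact gr_add0 : left_id gr_zero gr_add.
Proof. by move=> a; apply: gr_eqP => g; rewrite /= !ffunE add0r. Qed.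
Fact gr_addN : left_inverse gr_zero gr_opp gr_add.
Proof. by move=> a; congr GroupRing; apply: addNr. Qed.

HB.instance Definition _ := GRing.isZmodule.Build (groupring R G)
  gr_addA gr_addC gr_add0 gr_addN.

Fact gr_mulA : associative gr_mul.
Proof.
move=> a b c; apply: gr_eqP => g; rewrite /= !ffunE.
under eq_bigr do rewrite ffunE big_distrr /=.
under [RHS]eq_bigr do rewrite ffunE big_distrl /=.
rewrite [RHS]exchange_big /=; apply: eq_bigr => h _.
rewrite [RHS](reindex_inj (mulgI h)) /=; apply: eq_bigr => k _.
by rewrite mulrA mulKg invMg mulgA.
Qed.

Fact gr_mul1 : left_id gr_one gr_mul.
Proof.
move=> a; apply: gr_eqP => g; rewrite /= ffunE (bigD1 1%g) //= ffunE eqxx.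
rewrite mul1r invg1 mul1g big1 ?addr0 // => h /negPf h1.
by rewrite ffunE h1 mul0r.
Qed.

Fact gr_mulr1 : right_id gr_one gr_mul.
Proof.
move=> a; apply: gr_eqP => g; rewrite /= ffunE (bigD1 g) //= ffunE mulVg eqxx.
rewrite mulr1 big1 ?addr0 // => h /negPf hg.
by rewrite ffunE -eq_mulVg1 hg mulr0.
Qed.

Fact gr_mulDl : left_distributive gr_mul gr_add.
Proof.
move=> a b c; apply: gr_eqP => g; rewrite /= !ffunE -big_split /=.
by apply: eq_bigr => h _; rewrite ffunE mulrDl.
Qed.

Fact gr_mulDr : right_distributive gr_mul gr_add.
Proof.
move=> a b c; apply: gr_eqP => g; rewrite /= !ffunE -big_split /=.
by apply: eq_bigr => h _; rewrite ffunE mulrDr.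
Qed.

HB.instance Definition _ := GRing.Zmodule_isPzRing.Build (groupring R G)
  gr_mulA gr_mul1 gr_mulr1 gr_mulDl gr_mulDr.

Fact gr_scaleA r s a : gr_scale r (gr_scale s a) = gr_scale (r * s) a.
Proof. by apply: gr_eqP => g; rewrite /= !ffunE mulrA. Qed.
Fact gr_scale1 : left_id 1 gr_scale.
Proof. by move=> a; apply: gr_eqP => g; rewrite /= !ffunE mul1r. Qed.
Fact gr_scaleDr : right_distributive gr_scale +%R.
Proof. by move=> r a b; apply: gr_eqP => g; rewrite /= !ffunE mulrDr. Qed.
Fact gr_scaleDl a : {morph gr_scale^~ a : r s / r + s}.
Proof. by move=> r s; apply: gr_eqP => g; rewrite /= !ffunE mulrDl. Qed.

HB.instance Definition _ := GRing.Zmodule_isLmodule.Build R (groupring R G)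
  gr_scaleA gr_scale1 gr_scaleDr gr_scaleDl.

Fact gr_scaleAl r a b : r *: (a * b) = (r *: a) * b.
Proof.
apply: gr_eqP => g; rewrite /= !ffunE big_distrr /=.
by apply: eq_bigr => h _; rewrite ffunE mulrA.
Qed.

(* There is no lalgType instance: that structure requires 1 != 0, which fails
   when R is the zero ring. *)

End GroupRingStructure.

Section TwistedDerivations.

Variables (R : pzRingType) (G : finGroupType).
Notation RG := (groupring R G).
Variables sigma tau : RG -> RG.

(* The R-linearity of a derivation is carried by the type of D. *)
Definition twisted_derivation (D : {linear RG -> RG}) : Prop :=
  forall a b : RG, D (a * b) = D a * tau b + sigma a * D b.

Definition inner_twisted_derivation (D : RG -> RG) : Prop :=
  exists b : RG, forall a : RG, D a = b * tau a - sigma a * b.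

End TwistedDerivations.

(* Main.v *)
Require Import Defs.
From mathcomp Require Import all_boot all_fingroup all_algebra.

Import GRing.Theory.

Local Open Scope ring_scope.

(** The proof is the averaging argument behind Maschke's theorem.  Put
      b0 = \sum_g D(g) tau(g^-1).
    Substituting h g for g leaves the sum unchanged, and expanding D(h g) by
    the twisted Leibniz rule gives b0 = n D(h) tau(h^-1) + sigma(h) b0 tau(h^-1)
    for every h in G, that is, n D(h) = b0 tau(h) - sigma(h) b0
    (twisted_average).  With u the inverse of n, b = u b0 is therefore a witness
    of innerness on the elements of G.

    Extending this from G to RG by linearity takes care when R is not
    commutative, since b tau(r g) = b (r tau(g)) has to be turned into
    r (b tau(g)).  This is possible because b commutes with R.  Indeed sigma
    and tau fix every scalar r1, while D kills it, so that applying them to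
    r g = g r shows that sigma(g), tau(g) and D(g) all commute with R
    (scalar_commuting_endo, scalar_commuting_derivation); and u is central in R
    as the inverse of an integer. *)

Section GroupRingElements.

Context {R : pzRingType} {G : finGroupType}.
Notation RG := (groupring R G).
Implicit Types (a x y : RG) (r u : R).

Definition gr_elt (g : G) : RG := GroupRing [ffun h => (h == g)%:R].

Lemma gr_eltM g h : gr_elt (g * h)%g = gr_elt g * gr_elt h.
Proof.
apply: gr_eqP => k; rewrite /= !ffunE (bigD1 g) //= !ffunE eqxx mul1r.
rewrite big1 ?addr0 => [|l /negPf lg]; last by rewrite ffunE lg mul0r.
by rewrite -(inj_eq (mulgI g) _ h) mulKVg.
Qed.

Lemma gr_eltKV g : gr_elt g * gr_elt g^-1 = 1.
Proof. by rewrite -gr_eltM mulgV. Qed.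

Lemma gcoef_sum (I : Type) (s : seq I) (F : I -> RG) k :
  gcoef (\sum_(i <- s) F i) k = \sum_(i <- s) gcoef (F i) k.
Proof.
elim: s => [|i s IHs]; first by rewrite !big_nil ffunE.
by rewrite !big_cons ffunE IHs.
Qed.

Lemma gr_expand a : a = \sum_g gcoef a g *: gr_elt g.
Proof.
apply: gr_eqP => k; rewrite gcoef_sum (bigD1 k) //= !ffunE eqxx mulr1.
by rewrite big1 ?addr0 // => l /negPf lk; rewrite !ffunE eq_sym lk mulr0.
Qed.

Lemma scaleE r a : r *: a = r *: (1 : RG) * a.
Proof. by rewrite -gr_scaleAl mul1r. Qed.

(** The centralizer of R in RG, stated as R-linearity of left multiplication
    by x: this is the form in which scalars are moved out of products. *)
Definition scalar_commuting x := forall r y, x * (r *: y) = r *: (x * y).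

(** Testing on y = 1 suffices, by associativity of the product. *)
Lemma scalar_commuting1 x :
  (forall r, x * (r *: (1 : RG)) = r *: x) -> scalar_commuting x.
Proof. by move=> xC r y; rewrite scaleE mulrA xC gr_scaleAl. Qed.

Lemma scalar_commuting_elt g : scalar_commuting (gr_elt g).
Proof.
apply: scalar_commuting1 => r; apply: gr_eqP => k.
rewrite /= !ffunE (bigD1 g) //= !ffunE eqxx mul1r -eq_mulVg1 eq_sym.
by rewrite big1 ?addr0 // => l /negPf lg; rewrite ffunE lg mul0r.
Qed.

Lemma scalar_commutingM x y :
  scalar_commuting x -> scalar_commuting y -> scalar_commuting (x * y).
Proof. by move=> xC yC r z; rewrite -mulrA yC xC mulrA. Qed.

Lemma scalar_commuting_sum (F : G -> RG) :
  (forall g, scalar_commuting (F g)) -> scalar_commuting (\sum_g F g).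
Proof.
move=> FC r y; rewrite !big_distrl scaler_sumr /=.
by apply: eq_bigr => g _; apply: FC.
Qed.

Lemma scalar_commutingZ u x :
  (forall r, u * r = r * u) -> scalar_commuting x -> scalar_commuting (u *: x).
Proof.
by move=> uC xC r y; rewrite -!gr_scaleAl xC !scalerA uC.
Qed.

End GroupRingElements.

Lemma inv_nat_central (R : pzRingType) (n : nat) (u : R) :
  u * n%:R = 1 -> n%:R * u = 1 -> forall r, u * r = r * u.
Proof.
move=> un nu r.
by rewrite -[LHS]mulr1 -nu !mulrA -(mulrA u) commr_nat mulrA un mul1r.
Qed.

Section TwistedDerivationTheory.

Context {R : pzRingType} {G : finGroupType}.
Notation RG := (groupring R G).

(** A scalable ring morphism fixes the scalars r *: 1, so it preserves
    commutation with them. *)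
Lemma scalar_commuting_endo (f : {rmorphism RG -> RG}) (x : RG) :
  scalable f -> scalar_commuting x -> scalar_commuting (f x).
Proof.
move=> fZ xC; apply: scalar_commuting1 => r.
by rewrite -{1}(rmorph1 f) -fZ -rmorphM xC mulr1 fZ.
Qed.

Variables (sigma tau : {rmorphism RG -> RG}) (D : {linear RG -> RG}).
Hypothesis D_der : twisted_derivation sigma tau D.

Lemma twisted_derivation1 : D 1 = 0.
Proof.
have := D_der 1 1; rewrite mulr1 !rmorph1 mulr1 mul1r => /eqP.
by rewrite -subr_eq subrr eq_sym => /eqP.
Qed.

(** Since D kills the scalars and tau fixes them, D (x * (r *: 1)) is
    D x * (r *: 1); it is also D (r *: x) when x commutes with scalars. *)
Lemma scalar_commuting_derivation (x : RG) :
  scalable tau -> scalar_commuting x -> scalar_commuting (D x).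
Proof.
move=> tauZ xC; apply: scalar_commuting1 => r.
have := D_der x (r *: (1 : RG)).
rewrite xC mulr1 !linearZ tauZ rmorph1 /= twisted_derivation1.
by rewrite scaler0 mulr0 addr0.
Qed.

Definition derivation_average : RG :=
  \sum_g D (gr_elt g) * tau (gr_elt g^-1).

(** Reindexing the average by g |-> h g and expanding D (h g), each term
    contributes D(h) tau(g) tau(g^-1) tau(h^-1) = D(h) tau(h^-1), once for
    every g; the factor tau(h) on the right cancels tau(h^-1). *)
Lemma twisted_average (h : G) :
  D (gr_elt h) *+ #|G| =
  derivation_average * tau (gr_elt h) - sigma (gr_elt h) * derivation_average.
Proof.
apply/eqP; rewrite eq_sym subr_eq; apply/eqP.
rewrite {1}/derivation_average (reindex_inj (mulgI h)) /= big_distrl /=.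
rewrite -sumr_const big_distrr -big_split /=; apply: eq_bigr => g _.
rewrite -mulrA -rmorphM -gr_eltM invMg mulgKV gr_eltM D_der mulrDl.
by rewrite -!mulrA -rmorphM gr_eltKV rmorph1 mulr1.
Qed.

End TwistedDerivationTheory.

Theorem theorem4p17 (R : pzRingType) (G : finGroupType) (n : nat)
    (card_G : #|G| = n)
    (n_inv : exists u : R, u * n%:R = 1 /\ n%:R * u = 1)
    (sigma tau : {rmorphism groupring R G -> groupring R G})
    (sigma_lin : scalable sigma) (tau_lin : scalable tau)
    (D : {linear groupring R G -> groupring R G}) :
  twisted_derivation sigma tau D -> inner_twisted_derivation sigma tau D.
Proof.
move=> D_der; have [u [un nu]] := n_inv.
set b0 := derivation_average tau D; set b := u *: b0.
have b_comm : scalar_commuting b.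
  apply/scalar_commutingZ; first exact: inv_nat_central un nu.
  apply: scalar_commuting_sum => g; apply: scalar_commutingM.
    apply: scalar_commuting_derivation D_der _ tau_lin _.
    exact: scalar_commuting_elt.
  exact: scalar_commuting_endo (scalar_commuting_elt _).
have inner_elt g : D (gr_elt g) = b * tau (gr_elt g) - sigma (gr_elt g) * b.
  have sigmaC : scalar_commuting (sigma (gr_elt g)).
    exact: scalar_commuting_endo (scalar_commuting_elt _).
  rewrite sigmaC -gr_scaleAl -scalerBr -(twisted_average _ _ _ D_der) card_G.
  by rewrite -scaler_nat scalerA un scale1r.
exists b => a; rewrite (gr_expand a) !raddf_sum /= big_distrr big_distrl /=.
rewrite -sumrB; apply: eq_bigr => g _.
by rewrite linearZ /= inner_elt sigma_lin tau_lin b_comm -gr_scaleAl scalerBr.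
Qed.
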